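(* (i) For every fixed $\varepsilon>0$ and every fixed (finite) graph $G$ of chromatic number at most $3$ there is $n_0(G,\varepsilon)$ such that for every $n>n_0(G,\varepsilon)$, any family of at least $\varepsilon 2^n$ subsets of $[n]=\{1,2,\ldots,n\}$ contains a copy of $G(r)$ for some $r$. (ii) Similarly, for every fixed $\varepsilon>0$, every positive integer $k$, and every fixed (finite) $k$-uniform hypergraph $H$ whose vertex set is the disjoint union of $k+1$ subsets such that every edge contains at most one vertex in each subset, there is $n_0(H,\varepsilon)$ such that for every $n>n_0(H,\varepsilon)$, any family of at least $\varepsilon 2^n$ subsets of $[n]$ contains a copy of $H(r)$ for some $r$.
   Context: For a $k$-uniform hypergraph $H=(V,E)$ (a graph being the case $k=2$) and an integer $r\ge k$, the $r$-augmentation $H(r)$ of $H$ is the $r$-uniform hypergraph with vertex set $V\cup S$ and edge set $\{e\cup S: e\in E\}$, where $S$ is a set with $S\cap V=\emptyset$ and $|S|=r-k$. A family $\mathcal{F}$ of subsets of $[n]$ contains a copy of $H(r)$ if there is an injective map from $V\cup S$ to $[n]$ under which the image of every edge of $H(r)$ is a member of $\mathcal{F}$. *)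

(* Defs.v *)
From mathcomp Require Import all_boot all_order all_algebra.
From mathcomp Require Import reals.

Set Implicit Arguments.
Unset Strict Implicit.
Unset Printing Implicit Defensive.

Record hypergraph := Hypergraph {
  vertex : finType;
  edges : {set {set vertex}}
}.

Definition uniform (k : nat) (H : hypergraph) : Prop :=
  forall e : {set vertex H}, e \in edges H -> #|e| = k.

(* A (simple, finite) graph is a 2-uniform hypergraph; [proper_coloring] and
   [chromatic_number] are the usual notions on these and are not meant for
   k != 2. *)
Definition proper_coloring (G : hypergraph) (q : nat)
    (c : {ffun vertex G -> 'I_q}) : bool :=
  [forall x, forall y,
     (x != y) && ([set x; y] \in edges G) ==> (c x != c y)].

Definition colorable (G : hypergraph) (q : nat) : bool :=
  [exists c : {ffun vertex G -> 'I_q}, proper_coloring c].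

Lemma colorable_exists (G : hypergraph) : exists q, colorable G q.
Proof.
exists #|vertex G|; apply/existsP; exists [ffun x => enum_rank x].
apply/forallP => x; apply/forallP => y; apply/implyP => /andP[xy _].
by rewrite !ffunE (inj_eq enum_rank_inj).
Qed.

Definition chromatic_number (G : hypergraph) : nat :=
  ex_minn (colorable_exists G).

(* The parts are allowed to be empty. *)
Definition strongly_partite (q : nat) (H : hypergraph) : Prop :=
  exists P : 'I_q -> {set vertex H},
    [/\ \bigcup_(i < q) P i = [set: vertex H],
        forall i j : 'I_q, i != j -> [disjoint P i & P j]
      & forall e : {set vertex H}, e \in edges H ->
          forall i : 'I_q, #|e :&: P i| <= 1].

(* The r-augmentation H(r) of a k-uniform H, for k <= r. The added set S is the
   right summand of the vertex type. The uniformity k is an argument because H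
   does not determine it when H has no edge. *)
Definition augmentation (k r : nat) (H : hypergraph) : hypergraph :=
  @Hypergraph (vertex H + 'I_(r - k))%type
    [set (inl @: e) :|: (inr @: [set: 'I_(r - k)])
       | e : {set vertex H} in edges H].

(* The ground set [n] is represented by 'I_n. *)
Definition contains_copy (n : nat) (F : {set {set 'I_n}}) (H : hypergraph)
    : Prop :=
  exists2 f : vertex H -> 'I_n, injective f &
    forall e : {set vertex H}, e \in edges H -> f @: e \in F.

(* Main.v *)
Require Import Defs.
From mathcomp Require Import all_boot all_order all_algebra.
From mathcomp Require Import reals.
From mathcomp Require Import zify.

Set Implicit Arguments.
Unset Strict Implicit.
Unset Printing Implicit Defensive.

Import Order.TTheory GRing.Theory Num.Theory.

(** By Chebyshev's inequality, all but few sets A miss at least n/4 points, so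
    for a dense family F there are many pairs (B, b) with b in B and B \ b in F.
    Hence a typical B has linearly many such points b, and a positive proportion
    of all (B, D) with D a set of k+1 points of B satisfies B \ d in F for every d
    in D. By pigeonhole some S = B \ D occurs with a positive proportion of all
    the (k+1)-sets D. By Erdős's theorem these D contain a complete (k+1)-partite
    (k+1)-uniform hypergraph with large parts. An edge of H misses exactly one
    part, so it extends to a transversal D by a single point d, and
    S + (D \ d) is in F. Densities are expressed by
    N <= p * count in nat, which stands for count >= N / p. *)

(** * Second moment: few sets miss few points *)

(** Orthogonality of signs: once the square is expanded, the terms with [i != j] cancel over all [A]
    and each diagonal term gives [2 ^ #|T|]. *)
Lemma sum_sqr_signs (T : finType) :
  (\sum_(A : {set T}) (\sum_(i : T) (-1) ^+ (i \in A)) ^+ 2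
    = (#|T| * 2 ^ #|T|)%:R :> int)%R.
Proof.
transitivity (\sum_(i : T) \sum_(j : T) \sum_(A : {set T})
  ((-1) ^+ (i \in A) * (-1) ^+ (j \in A)) : int)%R.
  under eq_bigr => A _ do
    (rewrite expr2 big_distrl /=; under eq_bigr => i _ do rewrite big_distrr /=).
  by rewrite exchange_big; apply: eq_bigr => i _; rewrite exchange_big.
rewrite natrM mulr_natl -sumr_const; apply: eq_bigr => i _.
rewrite (bigD1 i) //= [X in (_ + X)%R]big1 ?addr0 => [|j ji].
  under eq_bigr => A _ do rewrite -signr_addb addbb expr0.
  by rewrite sumr_const -cardsT -powersetT card_powerset cardsT.
(* Toggling membership of [i] is an involution that negates every term. *)
pose h (A : {set T}) := if i \in A then A :\ i else i |: A.
have hK : involutive h.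
  move=> A; rewrite /h; case: (boolP (i \in A)) => iA.
    by rewrite !inE eqxx /= setD1K.
  by rewrite setU11 setU1K.
set s := bigop _ _ _; have : s = (- s)%R; last by lia.
rewrite {1}/s (reindex_inj (inv_inj hK)) /= -sumrN; apply: eq_bigr => A _.
have -> : i \in h A = (i \notin A).
  by rewrite /h; case: (boolP (i \in A)) => iA; rewrite !inE eqxx.
have -> : j \in h A = (j \in A).
  by rewrite /h; case: ifP => _; rewrite !inE (negPf ji).
by case: (i \in A); rewrite ?expr0 ?expr1 ?mulN1r ?mul1r ?opprK.
Qed.

Lemma sum_signs (T : finType) (A : {set T}) :
  (\sum_(i : T) (-1) ^+ (i \in A) = #|~: A|%:R - #|A|%:R :> int)%R.
Proof.
rewrite (bigID (mem A)) /= addrC; congr (_ + _)%R.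
  rewrite (eq_bigr (fun=> 1%R)) => [|i /negPf ->] //.
  by rewrite sumr_const; congr (1 *+ _)%R; apply: eq_card => i; rewrite inE.
rewrite (eq_bigr (fun=> (-1)%R)) => [|i ->] //.
by rewrite sumr_const mulNrn.
Qed.

(** Chebyshev: such an [A] has [#|A| - #|~: A|] at least [#|T| / 2], so it contributes at least
    [#|T| ^ 2 / 4] to the second moment. *)
Lemma card_few_missing (T : finType) :
  #|T| * #|[set A : {set T} | 4 * #|~: A| <= #|T|]| <= 4 * 2 ^ #|T|.
Proof.
have [->//|n0] := posnP #|T|.
set Z := [set A | _].
suff h : ((#|T| * #|T|)%:R *+ #|Z| <= (4 * (#|T| * 2 ^ #|T|)%:R) :> int)%R.
  by move: h; rewrite -mulr_natr -!natrM ler_nat; nia.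
rewrite -sum_sqr_signs mulr_sumr -sumr_const [leRHS](bigID [in Z]) /=.
rewrite -[leLHS]addr0 lerD //; last by apply: sumr_ge0 => A _; rewrite mulr_ge0 ?sqr_ge0.
apply: ler_sum => A; rewrite inE sum_signs => hA.
have cA := cardsC A; rewrite -sqrrN opprB !natz.
have : (#|T|%:Z <= 2 * (#|A|%:Z - #|~: A|%:Z))%R by lia.
move: #|T| (#|A|%:Z - _)%R => m z mz; nia.
Qed.

(** * Averaging and double counting *)

(** Reverse Markov inequality: the terms below [N / (2 * p)] make up at most half of the guaranteed
    sum, and every other term is at most [N]. *)
Lemma card_many_large (Y : finType) (d : Y -> nat) (N p : nat) :
  0 < N -> (forall y, d y <= N) -> N * #|Y| <= p * \sum_y d y ->
  #|Y| <= 2 * p * #|[set y | N <= 2 * p * d y]|.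
Proof.
move=> N0 dN h; set Z := [set y | _].
rewrite -(leq_pmul2l N0).
have h1 : 2 * p * \sum_y d y <= 2 * p * (N * #|Z|) + N * #|Y|.
  rewrite (bigID [in Z]) /= mulnDr leq_add //.
    by rewrite leq_mul2l (mulnC N) -sum_nat_const leq_sum ?orbT // => y _.
  rewrite big_distrr /= (mulnC N) -sum_nat_const [leqRHS](bigID [in Z]) /=.
  apply: leq_trans (leq_addl _ _); apply: leq_sum => y.
  by rewrite inE -ltnNge => /ltnW.
nia.
Qed.

Lemma exists_large_fiber (X : finType) (d : X -> nat) (M p : nat) :
  0 < M -> 0 < #|X| -> #|X| * M <= p * \sum_x d x -> exists x, M <= p * d x.
Proof.
move=> M0 X0 h; apply/existsP; apply: contraLR h => /existsPn h.
rewrite -ltnNge big_distrr /= -sum_nat_const.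
have : \sum_x (p * d x).+1 <= \sum_(x : X) M.
  by apply: leq_sum => x _; rewrite ltnNge.
apply: leq_trans; under [leqRHS]eq_bigr => x _ do rewrite -addn1.
by rewrite big_split /= sum1_card -[ltnLHS]addn0 ltn_add2l.
Qed.

Lemma sum_card_fibers (X Y : finType) (R : X -> Y -> bool) :
  \sum_(x : X) #|[set y | R x y]| = \sum_(y : Y) #|[set x | R x y]|.
Proof.
transitivity (\sum_(x : X) \sum_(y : Y) R x y : nat).
  by apply: eq_bigr => x _; rewrite -sum1dep_card big_mkcond.
rewrite exchange_big; apply: eq_bigr => y _.
by rewrite -sum1dep_card [RHS]big_mkcond.
Qed.

(** * A set [S] with a dense link *)

(** Pairs [(B, b)] correspond to pairs [(A, b)] with [A = B :\ b] in [F] and [b] outside [A]. As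
    [8 * p <= #|T|], at most half of the guaranteed size of [F] is lost to sets missing at most
    [#|T| / 4] points. *)
Lemma sum_card_removals (T : finType) (F : {set {set T}}) (p : nat) :
  2 ^ #|T| <= p * #|F| -> 8 * p <= #|T| ->
  #|T| * 2 ^ #|T| <=
    8 * p * \sum_(B : {set T}) #|[set b in B | B :\ b \in F]|.
Proof.
move=> hF hn; rewrite -sum_card_fibers.
have -> : \sum_b #|[set B : {set T} | (b \in B) && (B :\ b \in F)]|
        = \sum_b #|[set A : {set T} | (b \notin A) && (A \in F)]|.
  apply: eq_bigr => b _; rewrite -[LHS](card_in_imset (f := fun B => B :\ b)).
    apply: eq_card => A; rewrite inE; apply/imsetP/idP => [[B]|/andP[bA AF]].
      by rewrite inE => /andP[_ BF] ->; rewrite !inE eqxx.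
    by exists (b |: A); rewrite ?setU1K // inE setU11 setU1K.
  by move=> B C; rewrite !inE => /andP[bB _] /andP[bC _] e;
    rewrite -(setD1K bB) e setD1K.
rewrite sum_card_fibers.
have hc := card_few_missing T.
set Z := [set A : {set T} | _] in hc.
have h1 : #|F :\: Z| * #|T| <=
    4 * \sum_(A : {set T}) #|[set b | (b \notin A) && (A \in F)]|.
  rewrite -sum_nat_const big_distrr /= [leqRHS](bigID [in F :\: Z]) /=.
  apply: leq_trans (leq_addr _ _); apply: leq_sum => A.
  rewrite !inE -ltnNge => /andP[/ltnW hA ->].
  apply: leq_trans hA _; rewrite leq_mul2l /=; apply: subset_leq_card.
  by apply/subsetP => b; rewrite !inE andbT.
have h2 : #|F| <= #|F :\: Z| + #|Z|.
  by rewrite -(cardsID Z F) addnC leq_add2l subset_leq_card // subsetIr.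
have h3 : #|T| * 2 ^ #|T| <= p * (#|T| * #|F|) by nia.
have h4 : #|T| * #|F| <= #|T| * #|F :\: Z| + #|T| * #|Z| by nia.
have h5 := leq_mul (leqnn p) (leq_trans h4 (leq_add (leqnn _) hc)).
have h6 := leq_mul (leqnn p) h1; have h7 := leq_mul hn (leqnn (2 ^ #|T|)).
rewrite [#|T| * #|_ :\: _|]mulnC in h5.
move: (bigop _ _ _) h5 h6 h7 h3 => y.
move: (2 ^ _) (#|_ :\: _| * _) => N x *. lia.
Qed.

(** Removing [s] from [B] is injective on the sets [B] that contain [s]. *)
Lemma card_disjoint_link (T : finType) (F : {set {set T}}) (s : seq T) :
  #|[set B : {set T} | uniq s && all (fun x => (x \in B) && (B :\ x \in F)) s]|
  <= #|[set S : {set T} | uniq s &&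
         all (fun x => (x \notin S) && ((S :|: [set y in s]) :\ x \in F)) s]|.
Proof.
rewrite -(card_in_imset (f := fun B => B :\: [set y in s])).
  apply: subset_leq_card; apply/subsetP => S /imsetP[B].
  rewrite !inE => /andP[us /allP hB] ->; rewrite us /=.
  apply/allP => x xs; have /andP[xB hx] := hB x xs.
  rewrite !inE xs /=; suff -> : B :\: [set y in s] :|: [set y in s] = B by [].
  apply/setP => y; rewrite !inE; case: (boolP (y \in s)) => //= ys.
    by have /andP[->] := hB y ys.
  by rewrite orbF.
move=> B C; rewrite !inE => /andP[_ /allP hB] /andP[_ /allP hC] /setP e.
apply/setP => y; have := e y; rewrite !inE.
case: (boolP (y \in s)) => //= ys _.
by have /andP[-> _] := hB y ys; have /andP[-> _] := hC y ys.
Qed.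

Lemma expn_le_ffact (a b m q : nat) :
  m <= a * (b - q) -> m ^ q <= a ^ q * b ^_ q.
Proof.
move=> h; have: q <= q by []; elim: {-2}q => [|j IH] jq //.
rewrite !expnSr ffactnSr mulnACA leq_mul ?IH 1?[j <= q]ltnW //.
by apply: leq_trans h _; rewrite leq_mul2l leq_sub2l ?orbT // ltnW.
Qed.

(** The set [D] of removable points is listed as a duplicate-free tuple, the form on which Erdős's
    theorem can induct. The set [S] comes from averaging over all subsets of [T]. *)
Lemma dense_link (q p : nat) : exists p' n0 : nat,
  forall (T : finType) (F : {set {set T}}), n0 <= #|T| ->
  2 ^ #|T| <= p * #|F| ->
  exists S : {set T}, #|T| ^ q <= p' * #|[set s : q.-tuple T | uniq s &&
         all (fun x => (x \notin S) && ((S :|: [set y in s]) :\ x \in F)) s]|.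
Proof.
pose p1 := 8 * p.
(* A proportion [1 / (2 * p1)] of the sets [B] have [#|D B|] at least [#|T| / (2 * p1)]. Since
   [4 * p1 * q <= #|T|], even [#|D B| - q] is at least [#|T| / (4 * p1)], which bounds each factor
   of [#|D B| ^_ q]. *)
exists (2 * p1 * (4 * p1) ^ q), (p1 + 4 * p1 * q).+1 => T F hn hF.
have n0 : 0 < #|T| by apply: leq_trans hn.
pose D (B : {set T}) := [set b in B | B :\ b \in F].
have /(@card_many_large _ (fun B => #|D B|) #|T|) : #|T| * #|{set T}| <=
    p1 * \sum_(B : {set T}) #|D B|.
  rewrite -[#|{set T}|]cardsT -powersetT card_powerset cardsT.
  by apply: sum_card_removals => //; rewrite /p1 in hn *; lia.
move=> /(_ n0 (fun B => max_card _)) h.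
apply: exists_large_fiber => [||].
- by rewrite expn_gt0 n0.
- by apply/card_gt0P; exists set0.
rewrite sum_card_fibers.
apply: (@leq_trans (2 * p1 * (4 * p1) ^ q * \sum_(s : q.-tuple T)
  #|[set B : {set T} | uniq s && all (fun x => (x \in B) && (B :\ x \in F)) s]|));
  last first.
  by rewrite leq_mul2l leq_sum ?orbT // => s _; apply: card_disjoint_link.
rewrite -sum_card_fibers -mulnA.
apply: leq_trans (leq_mul h (leqnn _)) _; rewrite -mulnA leq_mul2l; apply/orP; right.
set Z := [set y | _]; rewrite -sum_nat_const big_distrr /=.
rewrite [leqRHS](bigID [in Z]) /=; apply: leq_trans (leq_addr _ _).
apply: leq_sum => B; rewrite inE => hB.
have -> : #|[set s : q.-tuple T | uniq s &&
    all (fun x => (x \in B) && (B :\ x \in F)) s]| = #|D B| ^_ q.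
  rewrite -card_uniq_tuples; apply: eq_card => s; rewrite !inE andbC.
  by congr (_ && _); apply: eq_all => x; rewrite -[RHS]/(x \in D B) inE.
apply: expn_le_ffact; move: hB hn => /=; rewrite mulnBr; move: (#|D B|) => d.
by clear; clearbody p1; nia.
Qed.

(** * Complete multipartite subhypergraphs *)

(** Greedy choice: averaging gives a new point of [T] related to a proportion [1 / (2 * p)] of the
    current [Y1], which is then restricted to those elements. *)
Lemma common_neighbours (t p : nat) (T Y : finType) (R : T -> Y -> bool)
    (Y0 : {set Y}) :
  0 < #|Y0| -> 0 < #|T| -> 2 * p * t <= #|T| ->
  {in Y0, forall y, #|T| <= p * #|[set x | R x y]|} ->
  exists (f : seq T) (Y1 : {set Y}),
    [/\ uniq f, size f = t, Y1 \subset Y0, #|Y0| <= (2 * p) ^ t * #|Y1|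
      & forall x y, x \in f -> y \in Y1 -> R x y].
Proof.
move=> Y00 T0 + hR; elim: t => [|t IH] ht.
  by exists [::], Y0; rewrite mul1n.
have [|f [Y1 [uf sf sY hY hf]]] := IH; first by lia.
have Y10 : 0 < #|Y1| by move: (leq_trans Y00 hY); rewrite muln_gt0 => /andP[].
suff [x xf hx] : exists2 x, x \notin f & #|Y1| <= 2 * p * #|[set y in Y1 | R x y]|.
  exists (x :: f), [set y in Y1 | R x y]; split => //=.
  - by rewrite xf.
  - by rewrite sf.
  - by apply: subset_trans sY; apply/subsetP => y; rewrite inE => /andP[].
  - by apply: leq_trans hY _; rewrite expnSr -mulnA leq_mul2l hx orbT.
  move=> z y; rewrite !inE => /orP[/eqP->|zf] /andP[yY ?] //.
  exact: hf.
pose R' x y := [&& x \notin f, y \in Y1 & R x y].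
have [x hx] : exists x, #|Y1| <= 2 * p * #|[set y | R' x y]|.
  apply: exists_large_fiber => //; rewrite sum_card_fibers mulnC -sum_nat_const.
  rewrite big_distrr [leqRHS](bigID [in Y1]) /=.
  apply: leq_trans (leq_addr _ _); apply: leq_sum => y yY.
  have := hR y (subsetP sY y yY).
  have : #|[set x | R x y]| <= #|[set x | R' x y]| + t.
    rewrite -(cardsID [set x in f]) addnC leq_add //.
      apply: subset_leq_card; apply/subsetP => x.
      by rewrite !inE /R' yY => /andP[-> ->].
    rewrite -sf -(card_uniqP uf) subset_leq_card //.
    by apply/subsetP => x; rewrite !inE => /andP[].
  (* Excluding the [t] points already chosen costs at most half of the guaranteed degree. *)
  have arith n r r' : 2 * p * t.+1 <= n -> r <= r' + t -> n <= p * r ->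
      n <= 2 * p * r'.
    by rewrite mulnS -!mulnA => hn /(leq_mul (leqnn p)); rewrite mulnDr; lia.
  exact: arith ht.
have [z] : exists z, z \in [set y | R' x y].
  by apply/card_gt0P; move: (leq_trans Y10 hx); rewrite muln_gt0 => /andP[].
rewrite inE => /and3P[xf _ _]; exists x => //; apply: leq_trans hx _.
rewrite leq_mul2l subset_leq_card ?orbT //.
by apply/subsetP => y; rewrite !inE => /and3P[_ -> ->].
Qed.

Lemma sum_tuple_cons (T : finType) (q : nat) (W : pred (seq T)) :
  #|[set s : q.+1.-tuple T | W s]|
    = \sum_(s : q.-tuple T) #|[set x | W (x :: s)]|.
Proof.
rewrite -sum_card_fibers.
transitivity #|[set u : T * q.-tuple T | W (u.1 :: u.2)]|.
  rewrite -(card_imset _ (f := fun u : T * q.-tuple T => [tuple of u.1 :: u.2])).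
    apply: eq_card => s; rewrite inE.
    apply/idP/imsetP => [|[u] /[!inE] Wu -> //].
    by case/tupleP: s => x s Ws; exists (x, s); rewrite ?inE.
  by move=> [x s] [y u] /= /(congr1 val) /= [-> e]; congr pair; apply: val_inj.
rewrite -sum1dep_card -(pair_big_dep xpredT (fun x (s : q.-tuple T) => W (x :: s)) (fun _ _ => 1)) /=.
by apply: eq_bigr => x _; rewrite sum1dep_card.
Qed.

(* Erdős's theorem. The parts are the rows of [G]; they are disjoint as soon as
   [W] implies [uniq]. *)
Lemma complete_multipartite (q t p : nat) : exists n0 : nat,
  forall (T : finType) (W : pred (seq T)), n0 <= #|T| ->
  #|T| ^ q <= p * #|[set s : q.-tuple T | W s]| ->
  exists G : seq (seq T),
    [/\ size G = q, all (fun g => uniq g && (size g == t)) G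
      & forall s, all2 (fun x g => x \in g) s G -> W s].
Proof.
elim: q p => [|q IH] p.
  exists 0 => T W _ h; exists [::]; split=> // -[|//] _.
  have: 0 < #|[set s : 0.-tuple T | W s]| by move: h; rewrite expn0; lia.
  by case/card_gt0P => s; rewrite inE tuple0.
(* The factor [2 * p] pays for keeping the tails with many heads, the power for passing to tails
   that share [t] heads. *)
have [n0 hn0] := IH (2 * p * (2 * (2 * p)) ^ t).
exists (n0 + 2 * (2 * p) * t).+1 => T W hn.
have T0 : 0 < #|T| by apply: leq_trans hn.
rewrite sum_tuple_cons expnS -card_tuple => h.
have {h} := card_many_large T0 (fun s => max_card _) h.
set Y0 := [set y | _] => hY.
have Y00 : 0 < #|Y0|.
  have : 0 < #|{: q.-tuple T}| by rewrite card_tuple expn_gt0 T0.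
  by move/leq_trans/(_ hY); rewrite muln_gt0 => /andP[].
have [||f [Y1 [uf sf sY1 hY1 hf]]] :=
  @common_neighbours t (2 * p) T _ (fun x s => W (x :: val s)) Y0 Y00 T0.
- by lia.
- by move=> s; rewrite inE.
(* Induction on the tails that every head in [f] extends to a tuple in [W]; [f] becomes the first
   part. *)
have [||G [sG uG hG]] := hn0 T (fun s => all (fun x => W (x :: s)) f); first lia.
  rewrite -card_tuple -mulnA; apply: leq_trans hY _.
  rewrite leq_mul2l (leq_trans hY1) ?orbT // leq_mul2l subset_leq_card ?orbT //.
  by apply/subsetP => s sY; rewrite inE; apply/allP => x xf; apply: hf.
exists (f :: G); split; rewrite /= ?sG ?uf ?sf ?eqxx ?uG //.
by case=> [//|x s] /= /andP[xf /hG /allP]; apply.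
Qed.

(** * Embedding the augmentation *)

(** With [r = #|S| + k] there are [#|S|] added vertices, which are sent onto [S] by its
    enumeration. *)
Lemma contains_augmentation (n k : nat) (F : {set {set 'I_n}}) (H : hypergraph)
    (S : {set 'I_n}) (f : vertex H -> 'I_n) :
  injective f -> (forall v, f v \notin S) ->
  (forall e, e \in edges H -> S :|: f @: e \in F) ->
  contains_copy F (augmentation k (#|S| + k) H).
Proof.
move=> f_inj fS fF; pose s j := enum_val (cast_ord (addnK k #|S|) j).
have s_inj : injective s by move=> i j /enum_val_inj /cast_ord_inj.
exists (fun x : vertex (augmentation k (#|S| + k) H) =>
          match x with inl v => f v | inr j => s j end).
  move=> [v|i] [w|j] => [/f_inj ->|e|e|/s_inj ->] //.
    by have := fS v; rewrite e enum_valP.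
  by have := fS w; rewrite -e enum_valP.
move=> e' /imsetP[e eH ->]; rewrite imsetU -!imset_comp setUC.
suff -> : [set s j | j in [set: 'I_(#|S| + k - k)]] = S by apply: fF.
apply/setP => x; apply/imsetP/idP => [[j _ ->]|xS]; first exact: enum_valP.
exists (cast_ord (esym (addnK k #|S|)) (enum_rank_in xS x)) => //.
by rewrite /s cast_ordKV enum_rankK_in.
Qed.

Lemma codom_transversal (T : eqType) (q t : nat) (x0 : T) (G : seq (seq T))
    (r : 'I_q -> nat) :
  size G = q -> all (fun g => uniq g && (size g == t)) G ->
  (forall i, r i < t) ->
  all2 (fun x g => x \in g) (codom (fun i : 'I_q => nth x0 (nth [::] G i) (r i))) G.
Proof.
move=> sG /allP uG rt.
(* Both sequences become images of [enum 'I_q], so one induction on that list treats them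
   together. *)
have {2}-> : G = map (nth [::] G \o val) (enum 'I_q).
  by rewrite map_comp val_enum_ord -sG -[LHS](mkseq_nth [::]).
rewrite /codom /image_mem; elim: (enum _) => //= i l ->.
have iG : nth [::] G i \in G by rewrite mem_nth // sG ltn_ord.
by rewrite andbT mem_nth //; have /andP[_ /eqP ->] := uG _ iG.
Qed.

Lemma dense_contains_augmentation (p k : nat) (H : hypergraph) :
  uniform k H -> strongly_partite k.+1 H ->
  exists n0 : nat, forall n : nat, n0 < n -> forall F : {set {set 'I_n}},
    2 ^ n <= p * #|F| ->
    exists2 r : nat, k <= r & contains_copy F (augmentation k r H).
Proof.
move=> uH [P [Pcov _ Pe]].
have /fin_all_exists[c cP] : forall v : vertex H, exists i, v \in P i.
  move=> v; have : v \in [set: vertex H] by [].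
  by rewrite -Pcov => /bigcupP[i _ vi]; exists i.
have c_inj e : e \in edges H -> {in e &, injective c}.
  move=> eH v w ve we cvw; apply: (card_le1_eqP (Pe e eH (c v))).
    by rewrite inE we cvw cP.
  by rewrite inE ve cP.
(* One position per vertex in each part; the successor keeps position 0 available even when [H] has
   no vertex. *)
pose t := #|vertex H|.+1.
have [p' [n1 h1]] := dense_link k.+1 p.
have [n2 h2] := complete_multipartite k.+1 t p'.
exists (n1 + n2) => n hn F hF.
have [||S hS] := h1 _ F; [by rewrite card_ord; lia|by rewrite card_ord|].
pose W (s : seq 'I_n) := uniq s &&
  all (fun x => (x \notin S) && ((S :|: [set y in s]) :\ x \in F)) s.
have [||G [sG uG hG]] := h2 _ W; [by rewrite card_ord; lia|by []|].
have n0 : 0 < n by lia.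
pose g (i : 'I_k.+1) := nth (Ordinal n0) (nth [::] G i).
have gW r : (forall i, r i < t) -> W (codom (fun i => g i (r i))).
  by move=> rt; apply: hG; exact: codom_transversal sG uG rt.
have g_inj r : (forall i, r i < t) -> injective (fun i => g i (r i)).
  by move=> /gW /andP[/injectiveP inj _]; exact: inj.
have gS r i : (forall i, r i < t) -> g i (r i) \notin S.
  by move=> /gW /andP[_ /allP /(_ _ (codom_f _ i)) /andP[]].
pose rank (v : vertex H) : nat := enum_rank v.
have rank_lt v : rank v < t by apply: ltnW; rewrite ltnS ltn_ord.
(* Vertices of one part are separated by their ranks, and vertices of different parts by the
   disjointness of the rows of [G]. *)
pose f v := g (c v) (rank v).
have f_inj : injective f.
  move=> v w; rewrite /f; have [<-|cvw] := eqVneq (c v) (c w).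
    have /allP /(_ _ (mem_nth [::] _)) := uG.
    move=> /(_ (c v)) /[!sG] /(_ (ltn_ord _)) /andP[ug /eqP sg].
    move/eqP; rewrite nth_uniq ?sg // => /eqP /val_inj.
    exact: enum_rank_inj.
  (* A transversal through both [f v] and [f w]; its entries are distinct. *)
  pose r i := if i == c v then rank v else rank w.
  have rt i : r i < t by rewrite /r; case: ifP.
  move=> e; have /eqP := cvw; case; apply: (g_inj r rt).
  by rewrite /r eqxx eq_sym (negPf cvw).
exists (#|S| + k); first exact: leq_addl.
apply: (contains_augmentation k f_inj) => [v|e eH].
  exact: (gS (fun=> rank v)).
(* The transversal through [f @: e], with the arbitrary position 0 in the part that [e] misses. *)
pose r i := if [pick v in e | c v == i] is Some v then rank v else 0.
have rt i : r i < t by rewrite /r; case: pickP.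
pose u i := g i (r i).
have uf v : v \in e -> u (c v) = f v.
  rewrite /u /r => ve; case: pickP => [w /andP[we /eqP cw]|/(_ v)].
    by rewrite (c_inj e eH w v we ve cw).
  by rewrite ve eqxx.
(* A transversal has [k + 1] points, so exactly one part is missed by [e]. *)
have /cards1P[i0 ci0] : #|~: (c @: e)| == 1.
  have := cardsC (c @: e); rewrite card_ord (card_in_imset (c_inj e eH)) uH //.
  by move=> ce; rewrite -(eqn_add2l k) ce addn1.
have ce i : (i \in c @: e) = (i != i0).
  by have /setP/(_ i) := ci0; rewrite !inE => <-; rewrite negbK.
(* Deleting the point [u i0] of the missed part from [S] plus the transversal leaves exactly
   [S :|: f @: e]. *)
have /andP[_ /allP /(_ (u i0) (codom_f _ i0)) /andP[u0S]] := gW r rt.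
congr (_ \in F); apply/setP => y; rewrite !inE.
apply/andP/orP => [[yu /orP[->|/codomP[i yi]]]|[yS|/imsetP[v ve ->]]]; first by left.
- right; have : i \in c @: e.
    by rewrite ce; apply: contra_neq yu => <-.
  by move=> /imsetP[v ve iv]; rewrite yi -/(u i) iv uf // imset_f.
- by split; [apply: contraNneq u0S => <-|rewrite yS].
- rewrite -uf //; split; last by rewrite codom_f orbT.
  by rewrite (inj_eq (g_inj r rt)) -ce imset_f.
Qed.

(** * Real densities, chromatic number and conclusion *)

Lemma dense_contains_augmentation_real (R : realType) (eps : R) (k : nat)
    (H : hypergraph) :
  (0 < eps)%R -> uniform k H -> strongly_partite k.+1 H ->
  exists n0 : nat, forall n : nat, n0 < n -> forall F : {set {set 'I_n}},
    (eps * 2%:R ^+ n <= #|F|%:R)%R ->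
    exists2 r : nat, k <= r & contains_copy F (augmentation k r H).
Proof.
(* As [p] is at least [eps^-1], a family of size at least [eps * 2 ^ n] satisfies
   [2 ^ n <= p * #|F|]. *)
move=> eps0 uH pH; pose p := Num.bound eps^-1%R.
have [n0 h] := dense_contains_augmentation p uH pH.
exists n0 => n hn F hF; apply: h => //.
rewrite -(ler_nat R) natrM natrX.
apply: le_trans (ler_wpM2l (ler0n _ _) hF).
rewrite mulrA ler_peMl ?exprn_ge0 // -ler_pdivrMr // mul1r.
by apply: ltW; apply: archi_boundP; rewrite invr_ge0 ltW.
Qed.

(** The parts are the colour classes of an optimal colouring, padded with empty ones. Two distinct
    vertices of an edge form the whole edge, so they differ in colour. *)
Lemma strongly_partite_chromatic (G : hypergraph) (q : nat) :
  uniform 2 G -> chromatic_number G <= q -> strongly_partite q G.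
Proof.
move=> uG; rewrite /chromatic_number; case: ex_minnP => m /existsP[c hc] _ mq.
exists (fun i => [set v | widen_ord mq (c v) == i]); split.
- apply/setP => v; rewrite inE; apply/bigcupP.
  by exists (widen_ord mq (c v)); rewrite ?inE.
- move=> i j ij; rewrite -setI_eq0; apply/eqP/setP => v; rewrite !inE.
  by apply/negP => /andP[/eqP -> /eqP]; apply/eqP.
move=> e eG i; apply/card_le1_eqP => x y; rewrite !inE.
move=> /andP[xe /eqP cx] /andP[ye /eqP cy].
apply/eqP; case: (eqVneq x y) => // xy.
have exy : e = [set x; y].
  by apply/eqP; rewrite eq_sym eqEcard subUset !sub1set xe ye cards2 xy (uG e).
move/forallP: hc => /(_ x) /forallP /(_ y); rewrite xy -exy eG /=.
by move/eqP; case; apply/val_inj; have := congr1 val (etrans cx (esym cy)).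
Qed.

Theorem mainTheorem7 :
  (forall (R : realType) (eps : R) (G : hypergraph),
     (0 < eps)%R -> uniform 2 G -> chromatic_number G <= 3 ->
     exists n0 : nat, forall n : nat, n0 < n ->
       forall F : {set {set 'I_n}},
         (eps * 2%:R ^+ n <= #|F|%:R)%R ->
         exists2 r : nat, 2 <= r & contains_copy F (augmentation 2 r G))
  /\
  (forall (R : realType) (eps : R) (k : nat) (H : hypergraph),
     (0 < eps)%R -> 0 < k -> uniform k H -> strongly_partite k.+1 H ->
     exists n0 : nat, forall n : nat, n0 < n ->
       forall F : {set {set 'I_n}},
         (eps * 2%:R ^+ n <= #|F|%:R)%R ->
         exists2 r : nat, k <= r & contains_copy F (augmentation k r H)).
Proof.
split=> [R eps G eps0 uG chiG | R eps k H eps0 _ uH pH].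
  exact/dense_contains_augmentation_real/strongly_partite_chromatic.
exact: dense_contains_augmentation_real.
Qed.
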